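(* If $G$ is a group, then the following statements are equivalent. (i) The complex group algebra $\mathbb{C}[G]$ is an algebraic Baer $^*$-algebra. (ii) $G$ is finite.
   Context: $\mathbb{C}[G]$ consists of all formal finite sums $\sum_{g\in G}\lambda_g g$ with $\lambda_g\in\mathbb{C}$, with the usual addition, scalar multiplication and product $\left(\sum_g\lambda_g g\right)\left(\sum_h\mu_h h\right)=\sum_{g,h}\lambda_g\mu_h\, gh$, and with involution $\left(\sum_g\lambda_g g\right)^*=\sum_g\overline{\lambda_g}g^{-1}$; thus it is a $^*$-algebra (a complex algebra with a conjugate-linear, anti-multiplicative, involutive map $^*$). An algebra is algebraic if each of its elements generates a finite dimensional subalgebra. A projection is an element $e$ with $e=e^*=e^2$. For a subset $S$ of a $^*$-algebra $A$, $\mathrm{ann}_r(S)=\{y\in A\mid ay=0\ \forall a\in S\}$. A Baer $^*$-algebra is a $^*$-algebra $A$ such that for every non-empty $S\subseteq A$ there is a projection $f\in A$ with $\mathrm{ann}_r(S)=fA$. *)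

(* Defs.v *)
From HB Require Import structures.
From mathcomp Require Import all_boot all_order all_algebra.
From mathcomp Require Import finmap complex monalg.
From mathcomp Require Import boolp classical_sets cardinality reals.

Set Implicit Arguments.
Unset Strict Implicit.
Unset Printing Implicit Defensive.

Import Order.TTheory GRing.Theory Num.Theory.

Local Open Scope classical_set_scope.
Local Open Scope ring_scope.

HB.mixin Record Algebra_isStarAlgebra (C : numClosedFieldType) A
    of GRing.Algebra C A := {
  star : A -> A;
  starD : forall x y, star (x + y) = star x + star y;
  starZ : forall (a : C) x, star (a *: x) = a^* *: star x;
  starM : forall x y, star (x * y) = star y * star x;
  starK : involutive star
}.

#[short(type="starAlgType")]
HB.structure Definition StarAlgebra (C : numClosedFieldType) :=
  { A of GRing.Algebra C A & Algebra_isStarAlgebra C A }.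

Section AlgebraicAlgebra.
Context (F : fieldType) (A : algType F).

(* Subalgebras need not contain 1. *)
Definition is_subalgebra (B : set A) : Prop :=
  [/\ B 0,
      forall x y, B x -> B y -> B (x + y),
      forall (a : F) x, B x -> B (a *: x) &
      forall x y, B x -> B y -> B (x * y)].

Definition generated_subalgebra (x : A) : set A :=
  [set y | forall B : set A, is_subalgebra B -> B x -> B y].

Definition finite_dimensional (B : set A) : Prop :=
  exists (n : nat) (b : 'I_n -> A),
    (forall i, B (b i)) /\
    (forall y, B y -> exists c : 'I_n -> F, y = \sum_(i < n) c i *: b i).

Definition algebraic_algebra : Prop :=
  forall x : A, finite_dimensional (generated_subalgebra x).

End AlgebraicAlgebra.
Arguments algebraic_algebra {F} A.

Section BaerStarAlgebra.
Context (C : numClosedFieldType) (A : starAlgType C).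

Definition projection (e : A) : Prop := e = star e /\ e = e * e.

Definition ann_r (S : set A) : set A :=
  [set y | forall a, S a -> a * y = 0].

Definition baer_star_algebra : Prop :=
  forall S : set A, S !=set0 ->
    exists2 f : A, projection f & ann_r S = [set f * y | y in [set: A]].

End BaerStarAlgebra.
Arguments baer_star_algebra {C} A.

(* [{malg C[G]}] is the space of formal finite sums over the bare type [G].  Its
   library product needs a [monomType], whose only invertible element is 1, so
   the product over a group is defined here, on an alias. *)
Definition group_algebra (C : numClosedFieldType) (G : groupType) : Type :=
  {malg C[G]}.

HB.instance Definition _ (C : numClosedFieldType) (G : groupType) :=
  GRing.Lmodule.on (group_algebra C G).

Section GroupAlgebra.
Context (C : numClosedFieldType) (G : groupType).
Local Notation CG := (group_algebra C G).
Implicit Types x y z : CG.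

Definition galg_one : CG := << 1 *g 1%g >>.

Definition galg_mul x y : CG :=
  \sum_(g <- msupp x) \sum_(h <- msupp y) << x@_g * y@_h *g (g * h)%g >>.

Definition galg_star x : CG :=
  \sum_(g <- msupp x) << (x@_g)^* *g (g^-1)%g >>.

Lemma galg_mulwl (d1 d2 : {fset G}) x y :
  (msupp x `<=` d1)%fset -> (msupp y `<=` d2)%fset ->
  galg_mul x y =
    \sum_(g <- d1) \sum_(h <- d2) << x@_g * y@_h *g (g * h)%g >>.
Proof.
move=> le_d1 le_d2; rewrite /galg_mul (big_fset_incl _ le_d1) /=.
  apply/eq_bigr=> g _; apply/big_fset_incl => // h _ /mcoeff_outdom ->.
  by rewrite mulr0 monalgU0.
move=> g _ /mcoeff_outdom xg.
by rewrite big1 => // h _; rewrite xg mul0r monalgU0.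
Qed.

Lemma galg_mulDl : left_distributive galg_mul +%R.
Proof.
move=> x y z.
rewrite (galg_mulwl (msuppD_le x y) (fsubset_refl (msupp z))).
rewrite (galg_mulwl (fsubsetUl _ (msupp y)) (fsubset_refl (msupp z))).
rewrite (galg_mulwl (fsubsetUr (msupp x) _) (fsubset_refl (msupp z))).
rewrite -big_split /=; apply/eq_bigr=> g _.
rewrite -big_split /=; apply/eq_bigr=> h _.
by rewrite mcoeffD mulrDl monalgUD.
Qed.

Lemma galg_mulDr : right_distributive galg_mul +%R.
Proof.
move=> z x y.
rewrite (galg_mulwl (fsubset_refl (msupp z)) (msuppD_le x y)).
rewrite (galg_mulwl (fsubset_refl (msupp z)) (fsubsetUl _ (msupp y))).
rewrite (galg_mulwl (fsubset_refl (msupp z)) (fsubsetUr (msupp x) _)).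
rewrite -big_split /=; apply/eq_bigr=> g _.
rewrite -big_split /=; apply/eq_bigr=> h _.
by rewrite mcoeffD mulrDr monalgUD.
Qed.

Lemma galg_mul0r x : galg_mul 0 x = 0.
Proof. by rewrite /galg_mul msupp0 big_seq_fset0. Qed.

Lemma galg_mulr0 x : galg_mul x 0 = 0.
Proof. by rewrite /galg_mul big1 // => g _; rewrite msupp0 big_seq_fset0. Qed.

Lemma galg_mulUU (a b : C) (g h : G) :
  galg_mul << a *g g >> << b *g h >> = << a * b *g (g * h)%g >>.
Proof. by rewrite (galg_mulwl msuppU_le msuppU_le) !big_seq_fset1 !mcoeffUU. Qed.

Lemma galg_ind (P : CG -> Prop) :
  P 0 -> (forall x y, P x -> P y -> P (x + y)) ->
  (forall (a : C) g, P << a *g g >>) -> forall x, P x.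
Proof.
move=> P0 PD PU x; rewrite (monalgE x).
by apply: (big_ind P) => // g _; apply: PU.
Qed.

Lemma galg_mulA : associative galg_mul.
Proof.
move=> x y z; elim/galg_ind: x => [|x1 x2 IH1 IH2|a g].
- by rewrite !galg_mul0r.
- by rewrite !galg_mulDl IH1 IH2.
elim/galg_ind: y => [|y1 y2 IH1 IH2|b h].
- by rewrite galg_mulr0 !galg_mul0r galg_mulr0.
- by rewrite galg_mulDl !galg_mulDr galg_mulDl IH1 IH2.
elim/galg_ind: z => [|z1 z2 IH1 IH2|c k].
- by rewrite !galg_mulr0.
- by rewrite !galg_mulDr IH1 IH2.
by rewrite !galg_mulUU mulrA mulgA.
Qed.

Lemma galg_mul1r : left_id galg_one galg_mul.
Proof.
elim/galg_ind => [|x y IH1 IH2|a g]; first exact: galg_mulr0.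
  by rewrite galg_mulDr IH1 IH2.
by rewrite galg_mulUU mul1r mul1g.
Qed.

Lemma galg_mulr1 : right_id galg_one galg_mul.
Proof.
elim/galg_ind => [|x y IH1 IH2|a g]; first exact: galg_mul0r.
  by rewrite galg_mulDl IH1 IH2.
by rewrite galg_mulUU mulr1 mulg1.
Qed.

Lemma galg_one_neq0 : galg_one != 0.
Proof. by rewrite /galg_one monalgU_eq0 oner_eq0. Qed.

HB.instance Definition _ := GRing.Zmodule_isNzRing.Build CG
  galg_mulA galg_mul1r galg_mulr1 galg_mulDl galg_mulDr galg_one_neq0.

Lemma galg_scaleU (c a : C) (g : G) :
  c *: (<< a *g g >> : CG) = << c * a *g g >>.
Proof. by apply/malgP => k; rewrite mcoeffZ !mcoeffU mulrnAr. Qed.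

Lemma galg_scaleAl (c : C) x y : c *: (x * y) = c *: x * y.
Proof.
elim/galg_ind: x => [|x1 x2 IH1 IH2|a g].
- by rewrite mul0r scaler0 mul0r.
- by rewrite mulrDl !scalerDr IH1 IH2 mulrDl.
elim/galg_ind: y => [|y1 y2 IH1 IH2|b h].
- by rewrite !mulr0 scaler0.
- by rewrite !mulrDr scalerDr IH1 IH2.
by rewrite galg_scaleU /GRing.mul /= !galg_mulUU galg_scaleU mulrA.
Qed.

Lemma galg_scaleAr (c : C) x y : c *: (x * y) = x * (c *: y).
Proof.
elim/galg_ind: x => [|x1 x2 IH1 IH2|a g].
- by rewrite !mul0r scaler0.
- by rewrite !mulrDl scalerDr IH1 IH2.
elim/galg_ind: y => [|y1 y2 IH1 IH2|b h].
- by rewrite scaler0 !mulr0 scaler0.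
- by rewrite scalerDr !mulrDr scalerDr IH1 IH2.
by rewrite galg_scaleU /GRing.mul /= !galg_mulUU galg_scaleU mulrCA.
Qed.

HB.instance Definition _ := GRing.Lmodule_isLalgebra.Build C CG galg_scaleAl.
HB.instance Definition _ := GRing.Lalgebra_isAlgebra.Build C CG galg_scaleAr.

Lemma galg_starw (d : {fset G}) x : (msupp x `<=` d)%fset ->
  galg_star x = \sum_(g <- d) << (x@_g)^* *g (g^-1)%g >>.
Proof.
move=> le_d; apply: big_fset_incl => // g _ /mcoeff_outdom ->.
by rewrite conjC0 monalgU0.
Qed.

Lemma galg_starU (a : C) (g : G) :
  galg_star << a *g g >> = << a^* *g (g^-1)%g >>.
Proof. by rewrite (galg_starw msuppU_le) big_seq_fset1 mcoeffUU. Qed.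

Lemma galg_starD x y : galg_star (x + y) = galg_star x + galg_star y.
Proof.
rewrite (galg_starw (msuppD_le x y)) (galg_starw (fsubsetUl _ (msupp y))).
rewrite (galg_starw (fsubsetUr (msupp x) _)) -big_split /=.
by apply/eq_bigr => g _; rewrite mcoeffD rmorphD monalgUD.
Qed.

Lemma galg_star0 : galg_star 0 = 0.
Proof. by rewrite /galg_star msupp0 big_seq_fset0. Qed.

Lemma galg_starZ (a : C) x : galg_star (a *: x) = a^* *: galg_star x.
Proof.
elim/galg_ind: x => [|x y IH1 IH2|b g].
- by rewrite scaler0 galg_star0 scaler0.
- by rewrite scalerDr !galg_starD IH1 IH2 scalerDr.
by rewrite galg_scaleU !galg_starU galg_scaleU rmorphM.
Qed.

Lemma galg_starM x y : galg_star (x * y) = galg_star y * galg_star x.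
Proof.
elim/galg_ind: x => [|x1 x2 IH1 IH2|a g].
- by rewrite mul0r galg_star0 mulr0.
- by rewrite mulrDl !galg_starD IH1 IH2 mulrDr.
elim/galg_ind: y => [|y1 y2 IH1 IH2|b h].
- by rewrite mulr0 galg_star0 mul0r.
- by rewrite mulrDr !galg_starD IH1 IH2 mulrDl.
by rewrite /GRing.mul /= !(galg_starU, galg_mulUU) rmorphM mulrC invgM.
Qed.

Lemma galg_starK : involutive galg_star.
Proof.
elim/galg_ind => [|x y IH1 IH2|a g]; first by rewrite !galg_star0.
  by rewrite !galg_starD IH1 IH2.
by rewrite !galg_starU conjCK invgK.
Qed.

HB.instance Definition _ := Algebra_isStarAlgebra.Build C CG
  galg_starD galg_starZ galg_starM galg_starK.

End GroupAlgebra.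

(* Main.v *)
Require Import Defs.
From mathcomp Require Import all_boot all_order all_algebra.
From mathcomp Require Import complex classical_sets cardinality reals.
From mathcomp Require Import finmap monalg boolp.

Set Implicit Arguments.
Unset Strict Implicit.
Unset Printing Implicit Defensive.

Import Order.TTheory GRing.Theory Num.Theory.

Local Open Scope ring_scope.

(** Write [tr x] for the coefficient of [x] at the identity. It is a trace, and
    [tr (star z * v)] is a positive definite inner product on the group algebra.

    Let [G] be finite. Every subspace of the group algebra is then finite
    dimensional, and every vector has an orthogonal projection onto it. For a
    right ideal [I], such as a right annihilator, the orthogonal complement is
    a right ideal too, so the orthogonal projection [f] of 1 onto [I] is a
    self-adjoint idempotent with [I = f A] ([right_ideal_projection]).

    Conversely, an algebraic group algebra forces [G] to be locally finite
    ([algebraic_locally_finite]): if [x] is the sum of the elements of a finite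
    set containing 1, the supports of the powers of [x] exhaust the submonoid generated by
    that set, while the powers of [x] span a finite dimensional space. If [G]
    is moreover infinite, it contains a strictly increasing chain of finite
    subgroups [H n]. Their averages [p_n] are decreasing idempotents, so the
    differences [e_n = p_n - p_(n+1)] are pairwise orthogonal idempotents.

    The Baer property fails for the set of all [e_n] with [n] even
    ([chain_not_baer]). If its right annihilator were [f A] with [f] idempotent,
    then [e_n f = 0] for even [n] and [f e_n = e_n] for odd [n]. But [f] has
    finite support, so from some index on all the [H n] meet the set of inverses
    of that support in the same set; hence for large [n], of either parity,
    [tr (e_n f) = s * tr e_n] with one constant [s], the sum of the coefficients
    of [f] over the union of the chain. As [tr e_n != 0], the even [n] give
    [s = 0] and the odd [n] give [s = 1]. *)

(** * Coefficients of products and the trace *)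
Section Coefficients.
Context (C : numClosedFieldType) (G : groupType).
Local Notation CG := (group_algebra C G).
Implicit Types x y z : CG.

Lemma mcoeff_galg_mul (d : {fset G}) x y k : (msupp x `<=` d)%fset ->
  (x * y)@_k = \sum_(g <- d) x@_g * y@_(g^-1 * k)%g.
Proof.
move=> le_d; elim/galg_ind: y => [|y1 y2 IH1 IH2|b h].
- by rewrite mulr0 mcoeff0 big1 // => g _; rewrite mcoeff0 mulr0.
- rewrite mulrDr !mcoeffD IH1 IH2 -big_split /=; apply: eq_bigr => g _.
  by rewrite mcoeffD mulrDr.
rewrite [_ * _](galg_mulwl le_d msuppU_le) raddf_sum /=.
apply: eq_bigr => g _; rewrite big_seq_fset1 mcoeffUU !mcoeffU mulrnAr.
by rewrite (can2_eq (mulKg g) (mulVKg g)).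
Qed.

Lemma mcoeff_galg_star x g : (star x)@_g = (x@_(g^-1)%g)^*.
Proof.
elim/galg_ind: x => [|x1 x2 IH1 IH2|a h].
- by rewrite [star 0]galg_star0 !mcoeff0 conjC0.
- by rewrite starD !mcoeffD IH1 IH2 rmorphD.
by rewrite [star _]galg_starU !mcoeffU rmorphMn /= -(inv_eq invgK).
Qed.

(** On basis elements this says that [g h = 1] exactly when [h g = 1]. *)
Lemma galg_traceC x y : (x * y)@_1%g = (y * x)@_1%g.
Proof.
elim/galg_ind: x => [|x1 x2 IH1 IH2|a g].
- by rewrite mul0r mulr0.
- by rewrite mulrDl mulrDr !mcoeffD IH1 IH2.
elim/galg_ind: y => [|y1 y2 IH1 IH2|b h].
- by rewrite mul0r mulr0.
- by rewrite mulrDl mulrDr !mcoeffD IH1 IH2.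
rewrite [_ * _]galg_mulUU [X in _ = X@_1%g]galg_mulUU !mcoeffU mulrC.
have inv1 u v : (u * v = 1 -> v * u = 1 :> G)%g.
  by move=> uv1; rewrite -[v](mulKg u) uv1 mulg1 mulVg.
by congr (_ *+ nat_of_bool _); apply/eqP/eqP; exact: inv1.
Qed.

(** The trace of [x * star x] is the sum of the squared moduli of the
    coefficients of [x]. *)
Lemma galg_trace_star_eq0 x : (x * star x)@_1%g = 0 -> x = 0.
Proof.
rewrite (mcoeff_galg_mul _ _ (fsubset_refl _)) => /eqP.
rewrite (eq_bigr (fun g => `|x@_g| ^+ 2)) => [|g _]; last first.
  by rewrite mcoeff_galg_star mulg1 invgK normCK.
rewrite psumr_eq0 => [/allP x0|g _]; last exact: exprn_ge0.
apply/malgP => g; rewrite mcoeff0; case: msuppP => // /x0 /=.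
by rewrite sqrf_eq0 normr_eq0 => /eqP.
Qed.

End Coefficients.

(** * Group algebras of finite groups *)
Section FiniteSupport.
Context (C : numClosedFieldType) (G : groupType).
Local Notation CG := (group_algebra C G).
Implicit Types (x y z : CG) (B : set CG).

Definition is_subspace B : Prop :=
  [/\ B 0, forall x y, B x -> B y -> B (x + y) &
      forall (a : C) x, B x -> B (a *: x)].

Lemma subspaceB B x y : is_subspace B -> B x -> B y -> B (x - y).
Proof. by case=> _ BD BZ Bx By; rewrite -scaleN1r; apply/BD/BZ. Qed.

Definition add_line B (b : CG) : set CG :=
  [set y | exists a : C, B (y - a *: b)]%classic.

(** A subspace whose elements are supported in [g :: gs] either vanishes at [g]
    throughout, or is spanned by one element not vanishing at [g] and the
    subspace of those elements that do. So it is reached from 0 by adding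
    lines, which serves as an induction on dimension without a notion of
    basis. *)
Lemma finite_support_subspace_ind (gs : seq G) (Q : set CG -> Prop) :
  Q [set 0]%classic ->
  (forall B b, is_subspace B -> Q B -> Q (add_line B b)) ->
  forall B, is_subspace B -> (forall y, B y -> {subset msupp y <= gs}) -> Q B.
Proof.
move=> Q0 Qadd; elim: gs => [|g gs IHgs] B [B0 BD BZ] suppB.
  rewrite (_ : B = [set 0]%classic) //; apply/seteqP; split=> y; last by move->.
  move=> /suppB no_supp; apply/malgP => k; rewrite mcoeff0.
  by case: msuppP => // /no_supp.
pose B' : set CG := [set y | B y /\ y@_g = 0]%classic.
have subB' : is_subspace B'.
  split=> [|x y [Bx x0] [By y0]|a x [Bx x0]]; split.
  - by [].
  - by rewrite mcoeff0.
  - exact: BD.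
  - by rewrite mcoeffD x0 y0 addr0.
  - exact: BZ.
  - by rewrite mcoeffZ x0 mulr0.
have QB' : Q B'.
  apply: IHgs => // y [By y0] k k_y; move: (suppB y By k k_y).
  by rewrite inE => /predU1P[kg|//]; move: k_y; rewrite kg -mcoeff_neq0 y0 eqxx.
have [[b Bb b_neq0]|no_b] := pselect (exists2 b, B b & b@_g != 0).
  rewrite (_ : B = add_line B' b); first exact: Qadd.
  apply/seteqP; split=> [y By|y [a [/BD By _]]].
    exists (y@_g / b@_g); split.
      by apply: subspaceB => //; apply: BZ.
    by rewrite mcoeffB mcoeffZ divfK ?subrr.
  by rewrite -[y](subrK (a *: b)); apply: By; apply: BZ.
rewrite (_ : B = B') //; apply/seteqP; split=> y; last by case.
move=> By; split=> //; apply/eqP; apply: contra_notT no_b => yg.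
by exists y.
Qed.

Lemma finite_support_finite_dimensional (gs : seq G) B :
  is_subspace B -> (forall y, B y -> {subset msupp y <= gs}) ->
  finite_dimensional B.
Proof.
move: B; apply: finite_support_subspace_ind.
  exists 0%N, (fun=> 0); split=> [[]//|y ->].
  by exists (fun=> 0); rewrite big_ord0.
move=> B b [B0 BD BZ] [n [c [Bc spanB]]].
exists n.+1, (fun i => oapp c b (unlift ord0 i)); split=> [i|y [a /spanB[d yE]]].
  case: unliftP => [j _|_] /=; first by exists 0; rewrite scale0r subr0.
  by exists 1; rewrite scale1r subrr.
exists (fun i => oapp d a (unlift ord0 i)).
rewrite big_ord_recl unlift_none /= -[LHS](subrK (a *: b)) yE addrC.
by congr (_ + _); apply: eq_bigr => i _; rewrite liftK.
Qed.

Lemma galg_star_trace_eq0 x : (star x * x)@_1%g = 0 -> x = 0.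
Proof. by rewrite galg_traceC => /galg_trace_star_eq0. Qed.

(** One Gram-Schmidt step per added line, for the inner product
    [<z, v> = trace (star z * v)]. *)
Lemma finite_support_orthogonal_projection (gs : seq G) B :
  is_subspace B -> (forall y, B y -> {subset msupp y <= gs}) ->
  forall v, exists2 f, B f & forall z, B z -> (star z * (v - f))@_1%g = 0.
Proof.
move: B; apply: finite_support_subspace_ind.
  move=> v; exists 0 => // z ->; rewrite [star 0]galg_star0 mul0r.
  exact: mcoeff0.
move=> B b subB projB v; have [_ BD BZ] := subB.
have [pb Bpb ortho_pb] := projB b; have [pv Bpv ortho_pv] := projB v.
pose w := b - pb.
pose c := (star w * (v - pv))@_1%g / (star w * w)@_1%g.
(* If w = 0, the division by 0 in c is harmless, since c is multiplied by w. *)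
exists (pv + c *: w) => [|z [a Bz]].
  exists c; rewrite scalerBr addrA addrAC addrK.
  by apply: subspaceB => //; apply: BZ.
have ortho_w : (star w * (v - (pv + c *: w)))@_1%g = 0.
  rewrite opprD addrA mulrBr mcoeffB -scalerAr mcoeffZ /c.
  have [/galg_star_trace_eq0 ->|w_neq0] := eqVneq (star w * w)@_1%g 0.
    by rewrite [star 0]galg_star0 !mul0r !mcoeff0 mulr0 subrr.
  by rewrite divfK ?subrr.
have -> : z = (z - a *: b + a *: pb) + a *: w.
  by rewrite scalerBr addrACA subrr addr0 subrK.
rewrite starD starZ mulrDl mcoeffD -scalerAl mcoeffZ ortho_w mulr0 addr0.
have Bz' : B (z - a *: b + a *: pb) by apply: BD => //; apply: BZ.
rewrite opprD addrA mulrBr mcoeffB -scalerAr mcoeffZ.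
by rewrite ortho_pv // ortho_pb // mulr0 subrr.
Qed.

(** The orthogonal complement of a right ideal is again a right ideal, because
    [<x a, y> = <x, y (star a)>]. So [1 - f] maps the right ideal [B] by left
    multiplication both into [B] and into its complement, hence to 0. *)
Lemma right_ideal_projection B f :
  is_subspace B -> (forall x y, B x -> B (x * y)) -> B f ->
  (forall z, B z -> (star z * (1 - f))@_1%g = 0) ->
  projection f /\ B = [set f * y | y in [set: CG]]%classic.
Proof.
move=> subB BM Bf ortho; set u := 1 - f in ortho *.
have u_kills z : B z -> u * z = 0.
  (* u z = z - f z is in B, hence so is (u z) (star z), which is orthogonal
     to u; cycling under the trace, u z is orthogonal to itself. *)
  move=> Bz; apply: galg_star_trace_eq0; rewrite mulrA galg_traceC mulrA.
  rewrite -[z in z * star _](starK z) -starM ortho //; apply: (BM).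
  by rewrite mulrBl mul1r; apply: (subspaceB subB) => //; apply: BM.
have fu0 : star f * u = 0.
  apply: galg_star_trace_eq0; rewrite mulrA -starM.
  by apply: ortho; apply: BM.
have star_f : star f = star f * f by apply/eqP; rewrite -subr_eq0 -fu0 mulrBr mulr1.
have sa : star f = f by rewrite star_f -[RHS]starK [in RHS]star_f starM starK.
split; first by split; rewrite ?sa // -[LHS]sa star_f sa.
apply/seteqP; split=> y; last by case=> z _ <-; apply: BM.
move=> By; exists y => //; apply/esym/eqP.
by rewrite -subr_eq0 -[X in X - _]mul1r -mulrBl u_kills.
Qed.

Lemma finite_group_algebraic : finite_set [set: G]%classic ->
  algebraic_algebra CG.
Proof.
move=> /finite_fsetP[d dE] x.
apply: (@finite_support_finite_dimensional d) => [|y _ g _].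
  split=> [A [] //|y z genY genZ A subA Ax|a y genY A subA Ax].
    by have [_ AD _ _] := subA; apply: AD; [apply: genY | apply: genZ].
  by have [_ _ AZ _] := subA; apply: AZ; apply: genY.
by have : [set: G]%classic g by []; rewrite dE.
Qed.

Lemma finite_group_baer : finite_set [set: G]%classic -> baer_star_algebra CG.
Proof.
move=> /finite_fsetP[d dE] S _.
have subI : is_subspace (ann_r S).
  split=> [a _|x y Ix Iy a Sa|c x Ix a Sa]; first exact: mulr0.
  - by rewrite mulrDr Ix // Iy // addr0.
  - by rewrite -scalerAr Ix // scaler0.
have IM x y : ann_r S x -> ann_r S (x * y).
  by move=> Ix a Sa; rewrite mulrA Ix // mul0r.
have [|f If ortho] :=
    finite_support_orthogonal_projection (gs := d) subI _ 1.
  by move=> y _ g _; have : [set: G]%classic g by []; rewrite dE.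
by have [proj_f IE] := right_ideal_projection subI IM If ortho; exists f.
Qed.

End FiniteSupport.

(** * Algebraic group algebras and local finiteness *)
Section LocallyFinite.
Context (C : numClosedFieldType) (G : groupType).
Local Notation CG := (group_algebra C G).
Implicit Types (x y : CG) (D H K M : {fset G}).

(** A finite submonoid of a group is a subgroup, so closure under inverses
    need not be recorded. *)
Definition mulg_stable H : Prop :=
  (1%g \in H) /\ {in H &, forall g h, (g * h)%g \in H}.

Lemma mcoeff_mulU (a : C) h x k :
  ((<< a *g h >> : CG) * x)@_k = a * x@_(h^-1 * k)%g.
Proof.
by rewrite (mcoeff_galg_mul _ _ msuppU_le) big_seq_fset1 mcoeffUU.
Qed.

Definition nonneg_coeffs x : Prop := forall g, 0 <= x@_g.

Lemma nonneg_coeffsM x y :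
  nonneg_coeffs x -> nonneg_coeffs y -> nonneg_coeffs (x * y).
Proof.
move=> x0 y0 g; rewrite (mcoeff_galg_mul _ _ (fsubset_refl _)).
by apply: sumr_ge0 => h _; apply: mulr_ge0.
Qed.

(** Without negative coefficients no cancellation can shrink the support of
    a product. *)
Lemma nonneg_msuppM x y g h : nonneg_coeffs x -> nonneg_coeffs y ->
  g \in msupp x -> h \in msupp y -> (g * h)%g \in msupp (x * y).
Proof.
move=> x0 y0 gx hy; rewrite -mcoeff_neq0.
rewrite (mcoeff_galg_mul _ _ (fsubset_refl _)).
rewrite psumr_neq0 => [|k _]; last exact: mulr_ge0.
apply/hasP; exists g => //=; rewrite mulKg mulr_gt0 //.
  by rewrite lt0r x0 mcoeff_neq0 gx.
by rewrite lt0r y0 mcoeff_neq0 hy.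
Qed.

Lemma generated_subalgebraX x n : generated_subalgebra x (x ^+ n.+1).
Proof.
move=> B [_ _ _ BM] Bx; elim: n => [|n IHn]; first by rewrite expr1.
by rewrite exprS; apply: BM.
Qed.

(** Let [x] be the sum of the elements of [D] and of 1. The supports of the
    powers of [x] lie in one finite set, as these powers span a finite
    dimensional space; their union is the submonoid generated by [D], because
    the coefficients of [x] are nonnegative. *)
Lemma algebraic_locally_finite D : algebraic_algebra CG ->
  exists2 M, mulg_stable M & {subset D <= M}.
Proof.
move=> algCG; pose E := (1%g |` D)%fset.
pose x : CG := \sum_(g <- E) << 1 *g g >>.
have xE g : x@_g = \sum_(h <- E) (h == g)%:R.
  by rewrite raddf_sum; apply: eq_bigr => h _ /=; rewrite mcoeffU.
have x_ge0 : nonneg_coeffs x by move=> g; rewrite xE; apply: sumr_ge0.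
have xX_ge0 n : nonneg_coeffs (x ^+ n.+1).
  elim: n => [|n IHn]; first by rewrite expr1.
  by rewrite exprS; apply: nonneg_coeffsM.
have x_supp g : g \in E -> g \in msupp x.
  move=> gE; rewrite -mcoeff_neq0 xE psumr_neq0 //; apply/hasP; exists g => //=.
  by rewrite eqxx ltr01.
have [n [b [_ span_b]]] := algCG x.
pose U := (\bigcup_(i <- enum 'I_n) msupp (b i))%fset.
pose M := [fset g in U | `[<exists n, g \in msupp (x ^+ n.+1)>]]%fset.
have inM k g : g \in msupp (x ^+ k.+1) -> g \in M.
  move=> gx; rewrite !inE /=; apply/andP; split; last by apply/asboolP; exists k.
  have [c xkE] := span_b (x ^+ k.+1) (@generated_subalgebraX x k).
  apply: contraLR gx => gU; rewrite -mcoeff_eq0 xkE raddf_sum big1 // => i _ /=.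
  rewrite mcoeffZ mcoeff_outdom ?mulr0 //; apply: contra gU => gb.
  by apply/bigfcupP; exists i; rewrite ?mem_enum.
have Mout g : g \in M -> exists k, g \in msupp (x ^+ k.+1).
  by rewrite !inE => /andP[_ /asboolP].
exists M => [|g gD].
  split=> [|g h]; first by apply: (inM 0); rewrite expr1 x_supp // !inE eqxx.
  move=> /Mout[k gk] /Mout[l hl]; apply: (inM (k + l.+1)%N); rewrite -addSn exprD.
  exact: nonneg_msuppM.
by apply: (inM 0); rewrite expr1 x_supp // !inE gD orbT.
Qed.

Lemma mulg_stable_chain : algebraic_algebra CG ->
  ~ finite_set [set: G]%classic ->
  exists H : nat -> {fset G},
    forall n, mulg_stable (H n) /\ (H n `<` H n.+1)%fset.
Proof.
move=> algCG infG.
have step H : exists K, mulg_stable K /\ (H `<` K)%fset.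
  have [g gH] : exists g, g \notin H.
    apply: contra_notP infG => allH; apply/finite_fsetP; exists H.
    apply/seteqP; split=> // g _ /=; apply: contra_notT allH => gH.
    by exists g.
  have [K K_st subK] := algebraic_locally_finite (g |` H)%fset algCG.
  exists K; split=> //; apply/andP; split.
    by apply/fsubsetP => h hH; rewrite subK // !inE hH orbT.
  by apply: contra gH => /fsubsetP; apply; rewrite subK // !inE eqxx.
have [F FP] := choice step.
(* The empty set is no submonoid, but F makes one out of any finite set. *)
exists (fun n => iter n.+1 F fset0) => n.
by split; [case: (FP (iter n F fset0)) | case: (FP (iter n.+1 F fset0))].
Qed.

End LocallyFinite.

(** * Averages over a chain of finite subgroups *)
Section Averages.
Context (C : numClosedFieldType) (G : groupType).
Local Notation CG := (group_algebra C G).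
Implicit Types (x y f : CG) (H K : {fset G}).

Definition subgroup_sum H : CG := \sum_(h <- H) << 1 *g h >>.
Definition average H : CG := (#|` H|%:R)^-1 *: subgroup_sum H.

Lemma mulg_stable_card_neq0 H : mulg_stable H -> #|` H|%:R != 0 :> C.
Proof. by case=> H1 _; rewrite pnatr_eq0 cardfs_eq0; apply/fset0Pn; exists 1%g. Qed.

(** Translation by an element of [H] permutes [K]. *)
Lemma average_absorb H K : mulg_stable H -> mulg_stable K ->
  {subset H <= K} ->
  average H * average K = average K /\ average K * average H = average K.
Proof.
move=> H_st [K1 KM] HK.
have reindex (s : G -> G) : injective s -> {in K, forall k, s k \in K} ->
    \sum_(k <- K) << 1 *g s k >> = subgroup_sum K.
  move=> s_inj sK; have sKE : (s @` K)%fset = K.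
    apply/eqP; rewrite eqEfcard card_imfset // leqnn andbT.
    by apply/fsubsetP => _ /imfsetP[k /= kK ->]; apply: sK.
  rewrite /subgroup_sum -[in RHS]sKE big_imfset //= => h k _ _.
  exact: s_inj.
have avg_const (z : CG) : z = \sum_(h <- H) subgroup_sum K ->
    (#|` H|%:R)^-1 *: z = subgroup_sum K.
  move=> ->; rewrite big_const_seq count_predT -/(#|` H|) iter_addr_0.
  by rewrite -scaler_nat scalerA mulVf ?scale1r // mulg_stable_card_neq0.
split; rewrite /average -scalerAl -scalerAr.
  rewrite scalerA mulrC -scalerA avg_const // mulr_suml !big_seq.
  apply: eq_bigr => h hH; rewrite mulr_sumr -[RHS](reindex (fun k => h * k)%g).
  - by apply: eq_bigr => k _; rewrite [_ * _]galg_mulUU mulr1.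
  - exact: mulgI.
  - by move=> k kK; apply: KM => //; apply: HK.
rewrite avg_const // mulr_sumr !big_seq.
apply: eq_bigr => h hH; rewrite mulr_suml -[RHS](reindex (fun k => k * h)%g).
- by apply: eq_bigr => k _; rewrite [_ * _]galg_mulUU mulr1.
- exact: mulIg.
- by move=> k kK; apply: KM => //; apply: HK.
Qed.

Lemma trace_average_mul H f :
  (average H * f)@_1%g = (#|` H|%:R)^-1 * \sum_(h <- H) f@_(h^-1)%g.
Proof.
rewrite -scalerAl mcoeffZ mulr_suml raddf_sum /=; congr (_ * _).
by apply: eq_bigr => h _; rewrite mcoeff_mulU mul1r mulg1.
Qed.

Lemma trace_average H : mulg_stable H -> (average H)@_1%g = (#|` H|%:R)^-1.
Proof.
case=> H1 _; rewrite mcoeffZ raddf_sum /= (big_fsetD1 1%g) //= mcoeffUU.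
rewrite big_seq big1 ?addr0 ?mulr1 // => h.
by rewrite !inE mcoeffU => /andP[/negPf -> _].
Qed.

Section Chain.
Context (H : nat -> {fset G}) (H_st : forall n, mulg_stable (H n)).
Context (H_proper : forall n, (H n `<` H n.+1)%fset).

Lemma chain_subset m n : (m <= n)%N -> {subset H m <= H n}.
Proof.
move=> /subnK <-; elim: (n - m)%N => // k IHk h /IHk; rewrite addSn.
by apply/fsubsetP; rewrite fproper_sub.
Qed.

Definition chain_step n : CG := average (H n) - average (H n.+1).

(** The product of two averages along the chain is the average over the larger
    subgroup, so the four terms of the expanded product cancel in pairs. *)
Lemma chain_step_ortho m n : m != n -> chain_step m * chain_step n = 0.
Proof.
have abs i j (le_ij : (i <= j)%N) :=
  average_absorb (H_st i) (H_st j) (chain_subset le_ij).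
rewrite neq_ltn => /orP[] lt_mn; have le_mn := ltnW lt_mn;
  rewrite mulrBl !mulrBr.
  rewrite (abs _ _ le_mn).1 (abs _ _ (leqW le_mn)).1.
  by rewrite (abs _ _ lt_mn).1 (abs _ _ (leqW lt_mn)).1 subrr.
rewrite (abs _ _ le_mn).2 (abs _ _ (leqW le_mn)).2.
by rewrite (abs _ _ lt_mn).2 (abs _ _ (leqW lt_mn)).2 !subrr.
Qed.

Lemma trace_chain_step_neq0 n : (chain_step n)@_1%g != 0.
Proof.
rewrite mcoeffB !trace_average // subr_eq0 (inj_eq invr_inj) eqr_nat.
by rewrite neq_ltn fproper_ltn_card.
Qed.

(** The trace of [average (H n) * f] is the sum of the coefficients of [f] at the
    inverses of the elements of [H n], divided by the order of [H n]; as [f] has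
    finite support, that sum stops changing along the chain. *)
Lemma trace_chain_step_mul f : exists (N : nat) (s : C),
  forall n, (N <= n)%N ->
    (chain_step n * f)@_1%g = (chain_step n)@_1%g * s.
Proof.
have [N NP] : exists N, forall g, g \in enum_fset (msupp f) ->
    forall n, (g^-1)%g \in H n -> (g^-1)%g \in H N.
  elim: (enum_fset _) => [|g gs [N NP]]; first by exists 0%N.
  have [[m gm]|no_m] := pselect (exists m, (g^-1)%g \in H m).
    exists (maxn m N) => k /predU1P[->|k_gs] n kn.
      exact: (chain_subset (leq_maxl m N)).
    by apply: (chain_subset (leq_maxr m N)); exact: NP k_gs _ kn.
  exists N => k /predU1P[->|k_gs] n kn; last exact: NP k_gs _ kn.
  by case: no_m; exists n.
exists N, (\sum_(h <- H N) f@_(h^-1)%g) => n le_Nn.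
have sumE m : (N <= m)%N ->
    \sum_(h <- H m) f@_(h^-1)%g = \sum_(h <- H N) f@_(h^-1)%g.
  move=> le_Nm; apply/esym/big_fset_incl => [|h hm hN].
    exact/fsubsetP/chain_subset.
  apply: mcoeff_outdom; apply: contra hN => hf.
  by rewrite -[h]invgK; apply: (NP _ hf m); rewrite invgK.
rewrite mulrBl !mcoeffB !trace_average_mul !trace_average //.
by rewrite !sumE // ?mulrBl // leqW.
Qed.

(** If [ann_r] of the even steps were [f A], then [f] would kill the even steps
    and fix the odd ones, while its traces against late steps of either parity
    are governed by one constant, which would be both 0 and 1. *)
Lemma chain_not_baer : ~ baer_star_algebra CG.
Proof.
move=> baerCG; pose S : set CG := [set chain_step n.*2 | n in setT]%classic.
have [|f [_ ff] annE] := baerCG S; first by exists (chain_step 0); exists 0%N.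
have [N [s sP]] := trace_chain_step_mul f.
have s0 : s = 0.
  have : ann_r S f by rewrite annE; exists 1; rewrite ?mulr1.
  move/(_ (chain_step N.*2)) => Nf.
  have /eqP := sP N.*2 (leq_trans (leq_addr N N) (eq_leq (addnn N))).
  rewrite Nf; last by exists N.
  by rewrite mcoeff0 eq_sym mulf_eq0 (negPf (trace_chain_step_neq0 _)) => /eqP.
have : ann_r S (chain_step N.*2.+1).
  move=> _ [n _ <-]; apply: chain_step_ortho; apply/eqP => /(congr1 odd).
  by rewrite /= !odd_double.
rewrite annE => -[y _ yE].
have /eqP := sP N.*2.+1 (leqW (leq_trans (leq_addr N N) (eq_leq (addnn N)))).
rewrite s0 mulr0 galg_traceC -yE mulrA -ff yE.
exact/negP/trace_chain_step_neq0.
Qed.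

End Chain.
End Averages.

Theorem theorem4p1 (R : realType) (G : groupType) :
  (algebraic_algebra (group_algebra R[i] G) /\
   baer_star_algebra (group_algebra R[i] G))
  <-> finite_set [set: G]%classic.
Proof.
split=> [[algCG baerCG]|finG]; last first.
  by split; [apply: finite_group_algebraic | apply: finite_group_baer].
apply: contrapT => infG; have [H HP] := mulg_stable_chain algCG infG.
by apply: (@chain_not_baer _ _ H) baerCG => n; case: (HP n).
Qed.
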